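(* Let $p,q\in(0,1/2)$ and suppose $K_{pq}$ is a twofold Cantor set. Then the Hausdorff dimension $d=\dim_H K_{pq}$ satisfies $p^d+q^d-(pq)^d=1/2$.
   Context: For $p,q\in(0,1/2)$ let $S_1(x)=px$, $S_2(x)=qx$, $S_3(x)=px+1-p$, $S_4(x)=qx+1-q$, let $K_{pq}$ be the attractor of $\{S_1,S_2,S_3,S_4\}$ (the unique nonempty compact $K\subset\mathbb R$ with $K=\bigcup_{i=1}^4S_i(K)$), and let $A=S_3(K_{pq})\cup S_4(K_{pq})$. $K_{pq}$ is called a twofold Cantor set if $S_1^m(A)\cap S_2^n(A)=\varnothing$ for all $m,n\in\mathbb N$. *)

(* Defs.v *)
From HB Require Import structures.
From mathcomp Require Import all_boot all_order all_algebra.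
From mathcomp Require Import all_classical all_reals all_analysis.
Set Implicit Arguments. Unset Strict Implicit. Unset Printing Implicit Defensive.
Import Order.TTheory GRing.Theory Num.Theory.
Import numFieldNormedType.Exports.
Local Open Scope classical_set_scope.
Local Open Scope ring_scope.

(* diameter of a set of reals: sup of |x - y| over x, y in U (0 if U empty) *)
Definition diam {R : realType} (U : set R) : R :=
  sup [set r | exists x y, U x /\ U y /\ r = `|x - y|].

Definition hterm {R : realType} (s : R) (U : set R) : R :=
  if asbool (U = set0) then 0 else powR (diam U) s.

Definition hausdorff_null {R : realType} (s : R) (E : set R) : Prop :=
  forall eps delta : R, 0 < eps -> 0 < delta ->
    exists U : nat -> set R,
      E `<=` \bigcup_i U i /\
      (forall i x y, U i x -> U i y -> `|x - y| <= delta) /\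
      (\sum_(0 <= i <oo) (hterm s (U i))%:E < eps%:E)%E.

Definition hausdorff_dim {R : realType} (E : set R) : R :=
  inf [set s | 0 <= s /\ hausdorff_null s E].

Definition S1 {R : realType} (p : R) (x : R) : R := p * x.
Definition S2 {R : realType} (q : R) (x : R) : R := q * x.
Definition S3 {R : realType} (p : R) (x : R) : R := p * x + 1 - p.
Definition S4 {R : realType} (q : R) (x : R) : R := q * x + 1 - q.

Definition is_attractor {R : realType} (p q : R) (K : set R) : Prop :=
  compact K /\ K !=set0 /\
  K = S1 p @` K `|` S2 q @` K `|` S3 p @` K `|` S4 q @` K.

Definition setA {R : realType} (p q : R) (K : set R) : set R :=
  S3 p @` K `|` S4 q @` K.

Definition twofold {R : realType} (p q : R) (K : set R) : Prop :=
  forall m n : nat, (0 < m)%N -> (0 < n)%N ->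
    (iter m (S1 p)) @` setA p q K `&` (iter n (S2 q)) @` setA p q K = set0.

(* Main.v *)
Require Import Defs.
From HB Require Import structures.
From mathcomp Require Import all_boot all_order all_algebra.
From mathcomp Require Import all_classical all_reals all_analysis.
From mathcomp Require Import ring lra.
Import Order.TTheory GRing.Theory Num.Theory.
Import numFieldNormedType.Exports.
Local Open Scope classical_set_scope.
Local Open Scope ring_scope.

(** Put [A = S3(K) `|` S4(K)].  Since [S1], [S2] commute and [K = 1 - K], up to the
    point [1] the set [A] is the union of its images under [x |-> 1 - p^m q^n x],
    [(m, n) <> (0, 0)], and the twofold condition says exactly that these images are
    disjoint.  The sum of the [s]-th powers of the ratios is
    [1 / ((1 - p^s) (1 - q^s)) - 1], which equals [1] iff
    [p^s + q^s - (pq)^s = 1/2].  If it is less than [1], subadditivity and scaling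
    force the [s]-content of [A], hence of [K], to vanish.  If it is greater than
    [1], finitely many of the maps already have sum at least [1]; their images are
    compact, hence a positive distance apart, and every finite cover of [A] can be
    rescaled to one with fewer sets and no larger cost until one of its sets is as
    large as that distance, which bounds the cost from below. *)

(** * Finite ball covers and the cost of covering separated images *)

(** Covers are lists of centre-radius pairs, so that affine rescaling and induction on the number of
    balls are plain list operations. *)
Definition ball_cover {R : realType} (l : seq (R * R)) (E : set R) : Prop :=
  (forall b, b \in l -> 0 < b.2) /\
  forall x, E x -> exists2 b, b \in l & `|x - b.1| < b.2.

Definition cost {R : realType} (s : R) (l : seq (R * R)) : R :=
  \sum_(b <- l) b.2 `^ s.

Lemma cost_ge0 {R : realType} (s : R) l : 0 <= cost s l.
Proof. by apply: sumr_ge0 => b _; exact: powR_ge0. Qed.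

Lemma cost_ge_mem {R : realType} (s : R) l b : b \in l -> b.2 `^ s <= cost s l.
Proof.
move=> bl; rewrite /cost (perm_big _ (perm_to_rem bl)) big_cons lerDl.
exact: cost_ge0.
Qed.

(* Induction on the number of balls: if no ball is large, each meets at most one
   of the pieces [f_i(X)], so the cover splits into covers of the pieces, and
   rescaling the cover of [f_i(X)] gives a cover of [X] by fewer balls. *)
Lemma separated_cost {R : realType} (I : finType) (P : pred I) (a b : I -> R)
    (X : set R) (delta s : R) :
  0 < delta -> 0 < s -> X !=set0 ->
  (forall i, P i -> a i != 0) ->
  (forall i x, P i -> X x -> X (a i * x + b i)) ->
  (forall i j x y, P i -> P j -> i != j -> X x -> X y ->
     delta <= `|(a i * x + b i) - (a j * y + b j)|) ->
  (forall i, P i -> exists2 j, P j & i != j) ->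
  1 <= \sum_(i | P i) `|a i| `^ s ->
  forall l, ball_cover l X -> (delta / 2) `^ s <= cost s l.
Proof.
move=> d0 s0 [x0 Xx0] an0 Xf gap P2 sum1 l.
have [n] := ubnP (size l); elim: n l => // n IH l szl [lpos lcov].
have [/hasP[c cl dc]|/hasPn small] := boolP (has (fun c => delta / 2 <= c.2) l).
  apply: le_trans (cost_ge_mem s _ _ cl); apply: ge0_ler_powR => //.
  - exact: ltW.
  - by rewrite nnegrE divr_ge0 // ltW.
  - by rewrite nnegrE ltW // lpos.
pose meets i (c : R * R) := `[< exists2 x, X x & `|a i * x + b i - c.1| < c.2 >].
have meets1 i j c : P i -> P j -> c \in l -> meets i c -> meets j c -> i = j.
  move=> Pi Pj cl /asboolP[x Xx hx] /asboolP[y Xy hy].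
  apply/eqP/negPn/negP => ij; have := gap i j x y Pi Pj ij Xx Xy.
  have := small _ cl; rewrite -ltNge => c2.
  have := ler_distD c.1 (a i * x + b i) (a j * y + b j).
  rewrite (distrC c.1); lra.
pose pull i (c : R * R) := ((c.1 - b i) / a i, c.2 / `|a i|).
pose li i := [seq c <- l | meets i c].
have coverli i : P i -> ball_cover (map (pull i) (li i)) X.
  move=> Pi; have ai := an0 _ Pi; split=> [_ /mapP[c + ->]|x Xx].
    by rewrite mem_filter => /andP[_ cl]; rewrite divr_gt0 ?lpos ?normr_gt0.
  have [c cl hc] := lcov _ (Xf _ _ Pi Xx).
  exists (pull i c).
    by apply: map_f; rewrite mem_filter cl andbT; apply/asboolP; exists x.
  rewrite /= ltr_pdivlMr ?normr_gt0 // -normrM mulrBl divfK //.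
  by rewrite [X in `|X|](_ : _ = a i * x + b i - c.1) //; ring.
have costli i : P i -> (delta / 2) `^ s * `|a i| `^ s <= cost s (li i).
  move=> Pi; have ai := an0 _ Pi.
  (* Another piece [j] exists, and the ball covering [a j * x0 + b j] cannot meet piece [i]; it is
     filtered out, so the list gets strictly shorter. *)
  have szi : (size (map (pull i) (li i)) < n)%N.
    rewrite size_map; apply: leq_trans (szl : (size l <= n)%N).
    rewrite size_filter ltn_neqAle count_size andbT -all_count.
    have [j Pj ij] := P2 _ Pi; have [c cl hc] := lcov _ (Xf _ _ Pj Xx0).
    apply/negP => /allP /(_ _ cl) mi; move/eqP: ij; apply.
    by apply: (meets1 _ _ c) => //; apply/asboolP; exists x0.
  have := IH _ szi (coverli _ Pi).
  rewrite /cost big_map /= => h.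
  rewrite -ler_pdivlMr ?powR_gt0 ?normr_gt0 //; apply: le_trans h _.
  rewrite mulr_suml big_seq [leRHS]big_seq ler_sum // => c.
  rewrite mem_filter => /andP[_ cl].
  rewrite powRM ?invr_ge0 ?(ltW (lpos _ cl)) //.
  by rewrite -[_^-1 in leLHS]powR_inv1 // powRAC powR_inv1 ?powR_ge0.
have : \sum_(i | P i) cost s (li i) <= cost s l.
  under eq_bigr do rewrite /cost big_filter big_mkcond /=.
  rewrite exchange_big /= /cost big_seq [leRHS]big_seq.
  apply: ler_sum => c cl; rewrite -big_mkcondr /=.
  have [/existsP[i /andP[Pi mi]]|] := boolP [exists i, P i && meets i c].
    rewrite (bigD1 i) ?Pi //= big1 ?addr0 // => j /andP[/andP[Pj mj] /eqP ji].
    by case: ji; apply: (meets1 _ _ c).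
  move/existsPn => no; rewrite big1 ?powR_ge0 // => i /andP[Pi mi].
  by have := no i; rewrite Pi mi.
apply: le_trans; apply: le_trans (ler_sum _ costli).
by rewrite -mulr_sumr ler_peMr // powR_ge0.
Qed.

(** * From null sets to finite ball covers *)

Lemma hterm_ge0 {R : realType} (s : R) U : 0 <= hterm s U.
Proof. by rewrite /hterm; case: ifP => // _; exact: powR_ge0. Qed.

Lemma dist_le_diam {R : realType} (U : set R) (delta x y : R) :
  (forall x y, U x -> U y -> `|x - y| <= delta) ->
  U x -> U y -> `|x - y| <= diam U.
Proof.
move=> Ud Ux Uy; apply: ub_le_sup; last by exists x, y.
by exists delta => _ [u [v [Uu [Uv ->]]]]; exact: Ud.
Qed.

Lemma geometric_half_sum {R : realType} (n : nat) :
  \sum_(0 <= i < n) (2^-1 : R) ^+ i.+1 <= 1.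
Proof.
rewrite [leLHS](_ : _ = 1 - 2^-1 ^+ n); first by rewrite gerBl exprn_ge0.
elim: n => [|n IH]; first by rewrite big_geq // expr0 subrr.
by rewrite big_nat_recr //= IH exprS; field.
Qed.

(** Each nonempty covering set lies in an open ball about one of its points whose cost exceeds
    [hterm] only slightly; compactness then leaves finitely many balls. *)
Lemma null_finite_cover {R : realType} (s : R) (E : set R) (eps : R) :
  0 < s -> 0 < eps -> compact E -> hausdorff_null s E ->
  exists2 l, ball_cover l E & cost s l < eps.
Proof.
move=> s0 e0 cE nE; have e2 : 0 < eps / 2 by rewrite divr_gt0.
(* Any mesh serves here: boundedness of [U i] makes [diam (U i)] a genuine supremum. *)
have [U [EU [Ud Us]]] := nE _ _ e2 e2.
pose e i := eps / 2 * 2^-1 ^+ i.+1.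
have ei i : 0 < e i by rewrite mulr_gt0 // exprn_gt0 // invr_gt0.
(* The summand [e i] makes the radius positive and strictly larger than the diameter, even for a
   single point. *)
pose rho i := (hterm s (U i) + e i) `^ s^-1.
have rho0 i : 0 < rho i by rewrite powR_gt0 // ltr_wpDl // hterm_ge0.
have rhos i : rho i `^ s = hterm s (U i) + e i.
  by rewrite -powRrM mulVf ?gt_eqF // powRr1 // addr_ge0 ?hterm_ge0 // ltW.
pose c i : R := xget 0 (U i).
have Urho i x : U i x -> `|x - c i| < rho i.
  move=> Ux; have Uc : U i (c i) by exact: (xgetI 0 Ux).
  apply: le_lt_trans (dist_le_diam _ _ _ _ (Ud i) Ux Uc) _.
  have D0 : 0 <= diam (U i).
    exact: le_trans (normr_ge0 _) (dist_le_diam _ _ _ _ (Ud i) Ux Uc).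
  rewrite ltNge; apply/negP => rD.
  have : rho i `^ s <= diam (U i) `^ s.
    by apply: ge0_ler_powR; rewrite ?nnegrE // ltW.
  rewrite rhos /hterm asboolF; last by move=> U0; rewrite U0 in Ux.
  by rewrite leNgt ltrDl ei.
move: cE; rewrite compact_cover => /(_ nat setT (fun i => ball (c i) (rho i))).
case=> [i _|x /EU[i _ /Urho]|D _ ED].
- exact: ball_open.
- by exists i => //; rewrite /ball /= distrC.
(* Passing from the finite index set [D] to an initial segment may add balls, but makes the cost a
   partial sum of the series. *)
pose N := (\max_(i <- finmap.enum_fset D) i).+1.
exists [seq (c i, rho i) | i <- index_iota 0 N].
  split=> [_ /mapP[i _ ->]|x /ED[i iD xi]]; first exact: rho0.
  exists (c i, rho i).
    apply: (map_f (fun i => (c i, rho i))).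
    by rewrite mem_index_iota ltnS; exact: leq_bigmax_seq.
  by move: xi; rewrite -ball_normE /= distrC.
rewrite /cost big_map /=; under eq_bigr do rewrite rhos.
rewrite big_split /= [eps]splitr; apply: ltr_leD.
  rewrite -lte_fin -sumEFin; apply: le_lt_trans Us.
  by apply: nneseries_lim_ge => i _ _; rewrite lee_fin hterm_ge0.
by rewrite -mulr_sumr ler_piMr ?geometric_half_sum // ltW.
Qed.

(** * Content by finite ball covers *)

(** A finite-cover variant of Hausdorff content, with radii for diameters and no bound on the mesh.
    Without any cover it is [inf set0 = 0], hence the coverability hypotheses below. *)
Definition content {R : realType} (s : R) (E : set R) : R :=
  inf [set c | exists2 l, ball_cover l E & c = cost s l].

Lemma content_ge0 {R : realType} (s : R) (E : set R) : 0 <= content s E.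
Proof.
rewrite /content; set C := (X in inf X).
have [->|/set0P ne] := eqVneq C set0; first by rewrite inf0.
by apply: lb_le_inf => // _ [l _ ->]; exact: cost_ge0.
Qed.

Lemma content_le {R : realType} (s : R) (E : set R) l :
  ball_cover l E -> content s E <= cost s l.
Proof.
move=> lE; apply: ge_inf; last by exists l.
by exists 0 => _ [l' _ ->]; exact: cost_ge0.
Qed.

Lemma content_approx {R : realType} (s : R) (E : set R) (e : R) :
  (exists l, ball_cover l E) -> 0 < e ->
  exists2 l, ball_cover l E & cost s l < content s E + e.
Proof.
move=> [l lE] e0.
have [|_ [l' l'E ->] lt] := @inf_adherent R
  [set c | exists2 l, ball_cover l E & c = cost s l] e e0.
- split; first by exists (cost s l), l.
  by exists 0 => _ [l' _ ->]; exact: cost_ge0.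
- by exists l'.
Qed.

Lemma unit_interval_coverable {R : realType} (E : set R) :
  E `<=` `[0, 1] -> exists l, ball_cover l E.
Proof.
move=> E01; exists [:: (0, 2)]; split=> [b|x /E01].
  by rewrite inE => /eqP -> /=.
rewrite /= in_itv /= => /andP[x0 x1]; exists (0, 2); rewrite ?inE //= subr0 ger0_norm //.
lra.
Qed.

Lemma content_setU {R : realType} (s : R) (E F G : set R) :
  (exists l, ball_cover l F) -> (exists l, ball_cover l G) ->
  E `<=` F `|` G -> content s E <= content s F + content s G.
Proof.
move=> cF cG EFG; apply/ler_addgt0Pr => e e0.
have e2 : 0 < e / 2 by rewrite divr_gt0.
have [l1 [l1p l1F] c1] := content_approx s F _ cF e2.
have [l2 [l2p l2G] c2] := content_approx s G _ cG e2.
have : ball_cover (l1 ++ l2) E.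
  split=> [b|x /EFG[/l1F|/l2G] [b bl xb]].
  - by rewrite mem_cat => /orP[/l1p|/l2p].
  - by exists b; rewrite // mem_cat bl.
  - by exists b; rewrite // mem_cat bl orbT.
by move/(content_le s); rewrite /cost big_cat /= -!/(cost s _); lra.
Qed.

Lemma content_affine {R : realType} (s a b : R) (E F : set R) :
  a != 0 -> (exists l, ball_cover l F) -> E `<=` (fun x => a * x + b) @` F ->
  content s E <= `|a| `^ s * content s F.
Proof.
move=> a0 cF EF; have as0 : 0 < `|a| `^ s by rewrite powR_gt0 // normr_gt0.
rewrite -ler_pdivrMl //; apply/ler_addgt0Pr => e e0.
have [l [lp lF] /ltW c1] := content_approx s F _ cF e0.
apply: le_trans c1; rewrite ler_pdivrMl //.
apply: le_trans (content_le s _ [seq (a * c.1 + b, `|a| * c.2) | c <- l] _) _.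
  split=> [_ /mapP[c /lp c2 ->]|x /EF[y Fy <-]].
    by rewrite mulr_gt0 // normr_gt0.
  have [c cl yc] := lF _ Fy.
  exists (a * c.1 + b, `|a| * c.2).
    exact: (map_f (fun c => (a * c.1 + b, `|a| * c.2))).
  rewrite /= [X in `|X|](_ : _ = a * (y - c.1)); last by ring.
  by rewrite normrM ltr_pM2l ?normr_gt0.
rewrite /cost big_map /= mulr_sumr big_seq [leRHS]big_seq ler_sum // => c /lp/ltW c2.
by rewrite powRM.
Qed.

(** A cheap cover is automatically fine: a total cost below the [s]-th power of [delta / 2] keeps
    every radius at most [delta / 2]. *)
Lemma content0_null {R : realType} (s : R) (E : set R) :
  0 < s -> (exists l, ball_cover l E) -> content s E = 0 -> hausdorff_null s E.
Proof.
move=> s0 cE E0 eps delta e0 d0.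
have two0 : 0 < (2 : R) `^ s by rewrite powR_gt0.
(* Diameters are at most twice the radii: the first bound absorbs the resulting factor, the second
   controls the mesh. *)
have m0 : 0 < Num.min (eps / 2 `^ s) ((delta / 2) `^ s).
  by rewrite lt_min divr_gt0 //= powR_gt0 // divr_gt0.
have [l [lp lE]] := content_approx s E _ cE m0.
rewrite E0 add0r lt_min => /andP[leps ldelta].
(* Beyond the end of [l] the sets are empty and [hterm] is [0], so the series becomes a finite
   sum. *)
pose U i := [set x : R | (i < size l)%N /\ `|x - (nth (0, 0) l i).1| < (nth (0, 0) l i).2].
have Ud i x y : U i x -> U i y -> `|x - y| <= 2 * (nth (0, 0) l i).2.
  move=> [_ hx] [_ hy].
  have := ler_distD (nth (0, 0) l i).1 x y; rewrite (distrC (nth _ _ _).1 y); lra.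
exists U; split; [|split].
- move=> x /lE[b bl xb]; exists (index b l) => //.
  by split; rewrite ?index_mem // nth_index.
- move=> i x y Ux Uy; apply: le_trans (Ud _ _ _ Ux Uy) _.
  case: Ux => il _; set b := nth _ _ _.
  have bl : b \in l by exact: mem_nth.
  rewrite -ler_pdivlMl // mulrC leNgt; apply/negP => bd.
  have : (delta / 2) `^ s < b.2 `^ s.
    by apply: gt0_ltr_powR => //; rewrite nnegrE ltW // ?lp // divr_gt0.
  by rewrite ltNge (le_trans (cost_ge_mem s _ _ bl)) // ltW.
have hU i : (i < size l)%N -> hterm s (U i) <= 2 `^ s * (nth (0, 0) l i).2 `^ s.
  move=> il; have b0 := lp _ (mem_nth (0, 0) il).
  rewrite -powRM ?(ltW b0) // /hterm; case: asboolP => [_|/eqP/set0P[x Ux]].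
    exact: powR_ge0.
  have xx : [set r | exists x y, U i x /\ U i y /\ r = `|x - y|] `|x - x|.
    by exists x, x.
  apply: ge0_ler_powR; rewrite ?nnegrE ?mulr_ge0 ?(ltW b0) ?(ltW s0) //.
    apply: le_trans (normr_ge0 (x - x)) _; apply: ub_le_sup => //.
    exists (2 * (nth (0, 0) l i).2) => _ [u [v [Uu [Uv ->]]]]; exact: Ud.
  apply: ge_sup; first by exists `|x - x|.
  by move=> _ [u [v [Uu [Uv ->]]]]; exact: Ud.
rewrite (nneseries_split 0 (size l)); last by move=> k _; rewrite lee_fin hterm_ge0.
rewrite add0n eseries0 ?adde0; last first.
  move=> i li _; rewrite /hterm asboolT //.
  by apply/seteqP; split=> // x [il _]; rewrite ltnNge li in il.
rewrite sumEFin lte_fin; rewrite ltr_pdivlMr // in leps; apply: le_lt_trans leps.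
rewrite /cost mulrC (big_nth (0, 0)) mulr_sumr big_nat [leRHS]big_nat.
by apply: ler_sum => i /andP[_ il]; exact: hU.
Qed.

(** * Contractions and compact sets on the line *)

Lemma expr_near_lt {R : realType} (z e : R) :
  0 <= z < 1 -> 0 < e -> \forall n \near \oo, z ^+ n < e.
Proof.
move=> /andP[z0 z1] e0.
have /cvgr0Pnorm_lt /(_ e e0) : (fun n => z ^+ n) @ \oo --> (0 : R).
  by apply: cvg_expr; rewrite ger0_norm.
by apply: filterS => n; apply: le_lt_trans; exact: ler_norm.
Qed.

(** Unfold a point of [K] [n] times and replace the innermost point by a fixed [t0] of [T]: the
    result is in [T] and has moved by at most [2^-n * C]. *)
Lemma contracted_sub_closed {R : realType} (K T : set R) :
  compact K -> closed T -> T !=set0 ->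
  (forall x, K x -> exists f : R -> R, exists y,
     [/\ K y, x = f y, forall t, T t -> T (f t) &
         forall u v, `|f u - f v| <= 2^-1 * `|u - v|]) ->
  K `<=` T.
Proof.
move=> cK cT [t0 Tt0] fK x Kx; apply: cT => B /nbhs_ballP[e /= e0 eB].
have [M [_ MK]] := compact_bounded cK.
have {}MK y : K y -> `|y| <= `|M| + 1.
  by move: y; apply: MK; rewrite (le_lt_trans (ler_norm M)) // ltrDl.
pose C := `|M| + 1 + `|t0|; have C0 : 0 < C by rewrite ltr_pwDl // ltr_pwDr.
have step n y : K y -> exists2 t, T t & `|y - t| <= 2^-1 ^+ n * C.
  elim: n y => [|n IH] y Ky.
    exists t0 => //; rewrite expr0 mul1r (le_trans (ler_normB _ _)) // lerD2r.
    exact: MK.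
  have [f [z [Kz -> Tf fc]]] := fK _ Ky; have [t Tt zt] := IH _ Kz.
  exists (f t); first exact: Tf.
  by rewrite exprS -mulrA (le_trans (fc _ _)) // ler_pM2l.
have [] := @expr_near_lt R 2^-1 (e / C) _ _.
- lra.
- exact: divr_gt0.
move=> N _ /(_ N (leqnn N)); rewrite /= ltr_pdivlMr // => hN.
have [t Tt xt] := step N _ Kx; exists t; split=> //; apply: eB.
by rewrite -ball_normE /=; exact: le_lt_trans hN.
Qed.

(* The set of differences of two compact sets is compact, hence closed. *)
Lemma compact_disjoint_gap {R : realType} (A B : set R) :
  compact A -> compact B -> A `&` B = set0 ->
  \forall d \near (0 : R)^'+, forall x y, A x -> B y -> d <= `|x - y|.
Proof.
move=> cA cB AB.
have cD : compact ((fun z : R * R => z.1 - z.2) @` (A `*` B)).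
  apply: continuous_compact; last exact: compact_setX.
  apply: continuous_subspaceT => z; apply: cvgB; [exact: cvg_fst|exact: cvg_snd].
have oD : open (~` ((fun z : R * R => z.1 - z.2) @` (A `*` B))).
  by apply: closed_openC; apply: compact_closed => //; exact: Rhausdorff.
have /nbhs_ballP[e /= e0 eD] : nbhs (0 : R) (~` ((fun z : R * R => z.1 - z.2) @` (A `*` B))).
  apply: open_nbhs_nbhs; split => // -[[x y] /= [Ax By]] /eqP; rewrite subr_eq0 => /eqP xy.
  have ABx : (A `&` B) x by split => //; rewrite xy.
  by rewrite AB in ABx.
near=> d => x y Ax By; rewrite leNgt; apply/negP => xyd.
apply: (eD (x - y)); last by exists (x, y).
rewrite -ball_normE /= sub0r normrN (lt_le_trans xyd) //.
by near: d; exact: nbhs_right_le.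
Unshelve. all: by end_near.
Qed.

(** * Geometry of the attractor *)

Lemma attractor_stable {R : realType} (p q : R) (K : set R) y :
  is_attractor p q K -> K y ->
  [/\ K (p * y), K (q * y), K (p * y + 1 - p) & K (q * y + 1 - q)].
Proof.
move=> [_ [_ KE]] Ky; split; rewrite KE.
- by do 3 left; exists y.
- by do 2 left; right; exists y.
- by left; right; exists y.
- by right; exists y.
Qed.

Lemma attractor_setA {R : realType} (p q : R) (K : set R) x :
  is_attractor p q K -> K x ->
  [\/ setA p q K x, exists2 y, K y & x = p * y | exists2 y, K y & x = q * y].
Proof.
move=> [_ [_ KE]]; rewrite {1}KE => -[[[|]|]|].
- by move=> [y Ky <-]; apply: Or32; exists y.
- by move=> [y Ky <-]; apply: Or33; exists y.
- by move=> ?; apply: Or31; left.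
- by move=> ?; apply: Or31; right.
Qed.

(** All four similarities contract by less than one half, so [contracted_sub_closed] applies. This
    takes the place of uniqueness of the attractor and yields its bounds and its symmetry. *)
Lemma attractor_minimal {R : realType} (p q : R) (K T : set R) :
  0 < p < 1 / 2 -> 0 < q < 1 / 2 -> is_attractor p q K ->
  closed T -> T !=set0 ->
  (forall t, T t ->
     [/\ T (p * t), T (q * t), T (p * t + 1 - p) & T (q * t + 1 - q)]) ->
  K `<=` T.
Proof.
move=> /andP[p0 p2] /andP[q0 q2] Kat cT T0 Tst.
have contr (a b : R) : 0 < a < 1 / 2 -> forall u v,
    `|(a * u + b) - (a * v + b)| <= 2^-1 * `|u - v|.
  move=> /andP[a0 a2] u v.
  rewrite [X in `|X|](_ : _ = a * (u - v)); last by ring.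
  by rewrite normrM ler_wpM2r // gtr0_norm //; lra.
apply: contracted_sub_closed => //; first by case: Kat.
have addA (a y : R) : a * y + 1 - a = a * y + (1 - a) by rewrite addrA.
move=> x /(attractor_setA _ _ _ _ Kat)[[]|| ] [y Ky].
- move=> <-; exists (fun t => p * t + (1 - p)), y; split; rewrite ?/S3 //.
  + by move=> t /Tst[_ _]; rewrite addA.
  + by apply: contr; rewrite p0.
- move=> <-; exists (fun t => q * t + (1 - q)), y; split; rewrite ?/S4 //.
  + by move=> t /Tst[_ _ _]; rewrite addA.
  + by apply: contr; rewrite q0.
- move=> ->; exists (fun t => p * t + 0), y; split; rewrite ?addr0 //.
  + by move=> t /Tst[]; rewrite addr0.
  + by apply: contr; rewrite p0.
- move=> ->; exists (fun t => q * t + 0), y; split; rewrite ?addr0 //.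
  + by move=> t /Tst[]; rewrite addr0.
  + by apply: contr; rewrite q0.
Qed.

Lemma attractor_unit {R : realType} (p q : R) (K : set R) :
  0 < p < 1 / 2 -> 0 < q < 1 / 2 -> is_attractor p q K -> K `<=` `[0, 1].
Proof.
move=> p2 q2 Kat; apply: (attractor_minimal p q) => //.
- exact: interval_closed.
- by exists 0; rewrite /= in_itv /= lexx ler01.
- move: p2 q2 => /andP[p0 p2] /andP[q0 q2] t; rewrite /= in_itv /= => /andP[t0 t1].
  by split; rewrite /= in_itv /=; apply/andP; split; nra.
Qed.

(** Reflection in [1 / 2] exchanges [S1] with [S3] and [S2] with [S4], so the reflected set is
    stable and contains [K] by minimality. *)
Lemma attractor_flip {R : realType} (p q : R) (K : set R) x :
  0 < p < 1 / 2 -> 0 < q < 1 / 2 -> is_attractor p q K -> K x -> K (1 - x).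
Proof.
move=> p2 q2 Kat; move: x; apply: (attractor_minimal p q K) => //.
- have /(preimage_closed _) : closed K.
    by apply: compact_closed; [exact: Rhausdorff|case: Kat].
  apply => x _; apply: cvgB; [exact: cvg_cst|exact: cvg_id].
- by case: (Kat) => _ [[x Kx] _]; exists (1 - x); rewrite /= opprB addrC subrK.
- move=> t /= /(attractor_stable _ _ _ _ Kat)[K1 K2 K3 K4]; split.
  + by rewrite (_ : 1 - _ = p * (1 - t) + 1 - p) //; ring.
  + by rewrite (_ : 1 - _ = q * (1 - t) + 1 - q) //; ring.
  + by rewrite (_ : 1 - _ = p * (1 - t)) //; ring.
  + by rewrite (_ : 1 - _ = q * (1 - t)) //; ring.
Qed.

(** * Upper bound: vanishing content *)

Lemma powR_lt1 {R : realType} (a s : R) : 0 <= a < 1 -> 0 < s -> a `^ s < 1.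
Proof.
move=> /andP[a0 a1] s0; rewrite [ltRHS](_ : 1 = 1 `^ s); last by rewrite powR1.
by apply: gt0_ltr_powR; rewrite ?nnegrE.
Qed.

(* With [L] the part of [K] outside [S1(K)], commutation of [S1] and [S2] gives
   [L <= A `|` S2(L)] and [1 - A <= S1(K) `|` S2(L)], which counts the overlap
   [S1(S2(K))] only once. *)
Lemma attractor_null {R : realType} (p q s : R) (K : set R) :
  0 < p < 1 / 2 -> 0 < q < 1 / 2 -> is_attractor p q K -> 0 < s ->
  p `^ s + q `^ s - (p * q) `^ s < 1 / 2 -> hausdorff_null s K.
Proof.
move=> p2 q2 Kat s0 pqs.
have K01 := attractor_unit _ _ _ p2 q2 Kat.
have sub_cover E : E `<=` K -> exists l, ball_cover l E.
  by move=> EK; apply: unit_interval_coverable => x /EK /K01.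
have cK := sub_cover K (@subset_refl _ K).
have flip x := attractor_flip _ _ _ x p2 q2 Kat.
have stab x := attractor_stable _ _ _ x Kat.
have cases x := attractor_setA _ _ _ x Kat.
move: p2 q2 => /andP[p0 p2] /andP[q0 q2].
(* The summand [0] gives the scalings the shape expected by [content_affine]. *)
pose A := setA p q K; pose S1K := (fun x => p * x + 0) @` K.
pose L := K `\` S1K; pose S2L := (fun x => q * x + 0) @` L.
pose B : set R := (fun x : R => (-1) * x + 1) @` A.
have AK : A `<=` K by move=> x [] [y /stab[_ _ k3 k4] <-].
have LK : L `<=` K by move=> x [].
have S1KK : S1K `<=` K by move=> x [y /stab[k1 _ _ _] <-]; rewrite addr0.
have S2LK : S2L `<=` K by move=> x [y /LK/stab[_ k2 _ _] <-]; rewrite addr0.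
have BK : B `<=` K by move=> x [y /AK/flip + <-]; rewrite mulN1r addrC.
have S2KE y : K y -> (S1K `|` S2L) (q * y).
  move=> Ky; have [[z Kz zy]|nS] := pselect (S1K y).
    by left; exists (q * z); [case: (stab _ Kz)|rewrite -zy; ring].
  by right; exists y; rewrite ?addr0.
have scaled (r : R) F : 0 < r -> (exists l, ball_cover l F) ->
    content s ((fun x => r * x + 0) @` F) <= r `^ s * content s F.
  by move=> r0 cF; rewrite -[r in leRHS]gtr0_norm // (content_affine s r 0) ?gt_eqF.
have hL : content s L <= content s A + q `^ s * content s L.
  apply: le_trans (content_setU s _ A S2L (sub_cover _ AK) (sub_cover _ S2LK) _) _.
    move=> x [/cases[Ax|[y Ky ->]|[y Ky ->]] nS]; first by left.
    - by case: nS; exists y; rewrite ?addr0.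
    - by case: (S2KE _ Ky) => // ?; right.
  by rewrite lerD2l; apply: scaled => //; exact: sub_cover.
have hK : content s K <= content s L + p `^ s * content s K.
  apply: le_trans (content_setU s _ L S1K (sub_cover _ LK) (sub_cover _ S1KK) _) _.
    by move=> x Kx; have [?|?] := pselect (S1K x); [right|left].
  by rewrite lerD2l; exact: scaled.
have hB : content s B <= p `^ s * content s K + q `^ s * content s L.
  apply: le_trans (content_setU s _ S1K S2L (sub_cover _ S1KK) (sub_cover _ S2LK) _) _.
    move=> _ [_ [] [y Ky <-] <-].
    - left; exists (1 - y); first exact: flip.
      by rewrite /S3; ring.
    - rewrite (_ : _ + 1 = q * (1 - y)); last by rewrite /S4; ring.
      exact/S2KE/flip.
  apply: lerD.
  - exact: scaled.
  - by apply: scaled => //; exact: sub_cover.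
have hA : content s A <= content s B.
  have := content_affine s (-1) 1 A B; rewrite normrN1 powR1 mul1r; apply.
  - by rewrite oppr_eq0 oner_eq0.
  - exact: sub_cover.
  - by move=> x Ax; exists (-1 * x + 1); [exists x|ring].
rewrite powRM ?ltW // in pqs.
have [P0 Q0] : 0 < p `^ s /\ 0 < q `^ s by rewrite !powR_gt0.
have [P1 Q1] : p `^ s < 1 /\ q `^ s < 1 by split; apply: powR_lt1 => //; lra.
have [A0 L0 k0] : [/\ 0 <= content s A, 0 <= content s L & 0 <= content s K].
  by split; exact: content_ge0.
apply: content0_null => //.
move: (p `^ s) (q `^ s) (content s A) (content s B) (content s L) (content s K)
  hA hB hK hL P0 Q0 P1 Q1 A0 L0 k0 pqs => P Q a b l k hA hB hK hL P0 Q0 P1 Q1 A0 L0 k0 pqs.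
(* These bounds chain to [(1 - P) * (1 - Q) * a <= (P + Q - P * Q) * a]. As [P + Q - P * Q < 1 / 2 <
   (1 - P) * (1 - Q)], this forces [a = 0], then [l = 0] and [k = 0]. *)
have h1 : (1 - Q) * l <= a by lra.
have h2 : (1 - P) * k <= l by lra.
have h3 : (1 - P) * (1 - Q) * (P * k + Q * l) <= (P + Q - P * Q) * a.
  have -> : (1 - P) * (1 - Q) * (P * k + Q * l) =
    P * (1 - Q) * ((1 - P) * k) + Q * (1 - P) * ((1 - Q) * l) by ring.
  have e1 : P * (1 - Q) * ((1 - P) * k) <= P * (1 - Q) * l.
    by rewrite ler_wpM2l // mulr_ge0 //; lra.
  have e2 : P * ((1 - Q) * l) <= P * a by rewrite ler_wpM2l // ltW.
  have e3 : Q * (1 - P) * ((1 - Q) * l) <= Q * (1 - P) * a.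
    by rewrite ler_wpM2l // mulr_ge0 //; lra.
  lra.
have h4 : (1 - P) * (1 - Q) * a <= (1 - P) * (1 - Q) * (P * k + Q * l).
  by rewrite ler_wpM2l ?mulr_ge0 //; lra.
have a0 : a = 0 by nra.
have l0 : l = 0 by nra.
nra.
Qed.

(** * Lower bound: disjoint images from the twofold condition *)

(** As [K] lies in the unit interval, the two pieces lie at or above [1 - p] and [1 - q]. Hence
    scaling [A] by a positive factor below [1 / 2] moves it off itself. *)
Lemma setA_gt_half {R : realType} (p q : R) (K : set R) x :
  0 < p < 1 / 2 -> 0 < q < 1 / 2 -> is_attractor p q K ->
  setA p q K x -> 1 / 2 < x <= 1.
Proof.
move=> p2 q2 Kat; have K01 := attractor_unit _ _ _ p2 q2 Kat.
move: p2 q2 => /andP[p0 p2] /andP[q0 q2].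
by case=> -[y /K01 + <-]; rewrite /S3 /S4 /= in_itv /= => /andP[y0 y1];
  apply/andP; split; nra.
Qed.

(** Cancel common powers. If all remaining ones are on one side, a nontrivial factor is below
    [1 / 2], which the position of [A] excludes; a power of [p] against a power of [q] is excluded
    by [twofold]. *)
Lemma twofold_scale_inj {R : realType} (p q : R) (K : set R) (m n m' n' : nat) x y :
  0 < p < 1 / 2 -> 0 < q < 1 / 2 -> is_attractor p q K -> twofold p q K ->
  setA p q K x -> setA p q K y ->
  p ^+ m * q ^+ n * x = p ^+ m' * q ^+ n' * y -> (m, n) = (m', n').
Proof.
move=> p2 q2 Kat tw; have half z := setA_gt_half _ _ _ z p2 q2 Kat.
move: p2 q2 => /andP[p0 p2] /andP[q0 q2].
have iterE (r z : R) i : iter i ( *%R r) z = r ^+ i * z.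
  by elim: i => [|i IH] /=; rewrite ?mul1r // IH exprS mulrA.
have twE i j u v : (0 < i)%N -> (0 < j)%N -> setA p q K u -> setA p q K v ->
    p ^+ i * u <> q ^+ j * v.
  move=> i0 j0 Au Av uv; have := tw i j i0 j0; rewrite -subset0 => /(_ (p ^+ i * u)).
  apply; split; first by exists u => //; exact: iterE.
  by exists v => //; rewrite uv; exact: iterE.
have small (r : R) i : 0 < r -> r < 1 / 2 -> (0 < i)%N -> r ^+ i < 1 / 2.
  move=> r0 r2; case: i => // i _; rewrite exprS.
  have : r ^+ i <= 1 by rewrite exprn_ile1 //; lra.
  have : 0 < r ^+ i by exact: exprn_gt0.
  nra.
have noscale i j u v : setA p q K u -> setA p q K v ->
    u = p ^+ i * q ^+ j * v -> i = 0%N /\ j = 0%N.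
  move=> /half /andP[u0 u1] /half /andP[v0 v1] uv.
  have pi : 0 < p ^+ i <= 1 by rewrite exprn_gt0 // exprn_ile1 //; lra.
  have qj : 0 < q ^+ j <= 1 by rewrite exprn_gt0 // exprn_ile1 //; lra.
  move: pi qj => /andP[pi0 pi1] /andP[qj0 qj1].
  have bound (a b : R) : 0 < a -> a < 1 / 2 -> 0 < b -> b <= 1 -> a * b * v < 1 / 2.
    move=> a0 a2 b0 b1; have : a * b <= a by rewrite ler_piMr // ltW.
    have : 0 < a * b by exact: mulr_gt0.
    nra.
  have [i0|i0] := posnP i; have [j0|j0] := posnP j => //.
  - exfalso; have := bound _ _ qj0 (small _ _ q0 q2 j0) pi0 pi1; rewrite (mulrC (q ^+ j)); lra.
  - exfalso; have := bound _ _ pi0 (small _ _ p0 p2 i0) qj0 qj1; lra.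
  - exfalso; have := bound _ _ pi0 (small _ _ p0 p2 i0) qj0 qj1; lra.
have injP (r : R) i : 0 < r -> injective ( *%R (r ^+ i)).
  by move=> r0; apply: mulfI; rewrite expf_neq0 // gt_eqF.
wlog mm' : m n m' n' x y / (m <= m')%N => [wh|] Ax Ay.
  case/orP: (leq_total m m') => mm' xy; first exact: (wh m n m' n' x y).
  by symmetry; apply: (wh m' n' m n y x).
rewrite -(subnKC mm'); set i := (m' - m)%N => xy.
have {}xy : q ^+ n * x = p ^+ i * q ^+ n' * y.
  apply: (injP p m p0); rewrite mulrA xy exprD; ring.
have [nn'|nn'] := leqP n n'.
  rewrite -(subnKC nn') in xy *; set j := (n' - n)%N in xy *.
  have [-> ->] : i = 0%N /\ j = 0%N.
    apply: (noscale _ _ x y) => //; apply: (injP q n q0).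
    by rewrite xy exprD; ring.
  by rewrite !addn0.
rewrite -(subnKC (ltnW nn')) in xy *; set j := (n - n')%N in xy *.
have j0 : (0 < j)%N by rewrite subn_gt0.
have {}xy : q ^+ j * x = p ^+ i * y.
  by apply: (injP q n' q0); rewrite mulrA -exprD xy; ring.
have [i0|i0] := posnP i; last by case: (twE i j y x).
rewrite i0 expr0 mul1r in xy.
have [_ j00] : 0%N = 0%N /\ j = 0%N.
  by apply: (noscale _ _ y x) => //; rewrite expr0 mul1r.
by rewrite j00 in j0.
Qed.

Lemma setA_compact {R : realType} (p q : R) (K : set R) :
  is_attractor p q K -> compact (setA p q K).
Proof.
move=> [cK _]; apply: compactU; apply: continuous_compact => //;
  apply: continuous_subspaceT => x.
- rewrite /S3; apply: cvgB; last exact: cvg_cst.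
  by apply: cvgD; [apply: cvgM; [exact: cvg_cst|exact: cvg_id]|exact: cvg_cst].
- rewrite /S4; apply: cvgB; last exact: cvg_cst.
  by apply: cvgD; [apply: cvgM; [exact: cvg_cst|exact: cvg_id]|exact: cvg_cst].
Qed.

(** The leading [1] restores the omitted term, and the full double sum factors into two finite
    geometric sums. *)
Lemma sum_pair_geometric {R : realType} (P Q : R) (n : nat) :
  (1 - P) * (1 - Q) * (1 + \sum_(i : 'I_n.+1 * 'I_n.+1 | i != (ord0, ord0))
    P ^+ i.1 * Q ^+ i.2) = (1 - P ^+ n.+1) * (1 - Q ^+ n.+1).
Proof.
have geo (z : R) : (1 - z) * \sum_(i < n.+1) z ^+ i = 1 - z ^+ n.+1.
  by apply: oppr_inj; rewrite -mulNr !opprB -subrX1.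
have <- : \sum_(i : 'I_n.+1 * 'I_n.+1) P ^+ i.1 * Q ^+ i.2 = 1 +
    \sum_(i : 'I_n.+1 * 'I_n.+1 | i != (ord0, ord0)) P ^+ i.1 * Q ^+ i.2.
  by rewrite (bigD1 (ord0, ord0)) //= !expr0 mulr1.
rewrite -(pair_bigA _ (fun i j : 'I_n.+1 => P ^+ i * Q ^+ j)) /=.
by rewrite -big_distrlr /= mulrACA !geo.
Qed.

Lemma powR_exprn {R : realType} (a s : R) (n : nat) :
  0 <= a -> (a ^+ n) `^ s = (a `^ s) ^+ n.
Proof. by move=> a0; rewrite -powR_mulrn // powRAC powR_mulrn ?powR_ge0. Qed.

Lemma twofold_not_null {R : realType} (p q s : R) (K : set R) :
  0 < p < 1 / 2 -> 0 < q < 1 / 2 -> is_attractor p q K -> twofold p q K ->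
  0 < s -> 1 / 2 < p `^ s + q `^ s - (p * q) `^ s -> ~ hausdorff_null s K.
Proof.
move=> p2 q2 Kat tw s0 pqs nK.
have flip x := attractor_flip _ _ _ x p2 q2 Kat.
have stab x := attractor_stable _ _ _ x Kat.
have inj m n m' n' x y := twofold_scale_inj _ _ _ m n m' n' x y p2 q2 Kat tw.
pose A := setA p q K.
have AK : A `<=` K by move=> x [] [y /stab[_ _ k3 k4] <-].
have cA : compact A := setA_compact _ _ _ Kat.
move: p2 q2 => /andP[p0 p2] /andP[q0 q2].
rewrite powRM ?ltW // in pqs.
have P01 : 0 <= p `^ s < 1 by rewrite powR_ge0 powR_lt1 //; lra.
have Q01 : 0 <= q `^ s < 1 by rewrite powR_ge0 powR_lt1 //; lra.
set P := p `^ s in pqs P01; set Q := q `^ s in pqs Q01.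
(* With [e = P + Q - P * Q - 1 / 2], these bounds give [(1 - P^(M+1)) * (1 - Q^(M+1)) > 1 - 2 * e =
   2 * (1 - P) * (1 - Q)], so the [s]-th powers of the ratios sum to more than [1]. Positivity of
   [M] provides two distinct nonzero index pairs. *)
have [M M0 [PM QM]] : exists2 M, (0 < M)%N & P ^+ M.+1 < P + Q - P * Q - 1 / 2 /\
    Q ^+ M.+1 < P + Q - P * Q - 1 / 2.
  have e0 : 0 < P + Q - P * Q - 1 / 2 by lra.
  have [M _ HM] := filterI (expr_near_lt _ _ P01 e0) (expr_near_lt _ _ Q01 e0).
  by exists M.+1 => //; apply: HM => /=; rewrite !leqW.
pose I := ('I_M.+1 * 'I_M.+1)%type; pose nz := fun i : I => i != (ord0, ord0).
pose r (i : I) := p ^+ i.1 * q ^+ i.2.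
have r0 i : 0 < r i by rewrite mulr_gt0 // exprn_gt0.
(* Peel one factor off the scale: [1 - p * z] is [S3] of [1 - z], which is in [K] by symmetry;
   likewise for [q] and [S4]. *)
have rA i x : nz i -> A x -> A (- r i * x + 1).
  move=> nzi Ax.
  have Kpow (k l : nat) : K (p ^+ k * q ^+ l * x).
    elim: k => [|k IH].
      elim: l => [|l IH]; first by rewrite !mul1r; exact: AK.
      by case: (stab _ IH) => _ + _ _; rewrite exprS !mul1r mulrA.
    by case: (stab _ IH) => + _ _ _; rewrite exprS !mulrA.
  case: i nzi => -[[|k] hk] [[|l] hl] //= _; rewrite /r /=.
  - right; exists (1 - p ^+ 0 * q ^+ l * x); first exact/flip.
    by rewrite /S4 [in RHS]exprS; ring.
  - left; exists (1 - p ^+ k * q ^+ 0 * x); first exact/flip.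
    by rewrite /S3 [in RHS]exprS; ring.
  - left; exists (1 - p ^+ k * q ^+ l.+1 * x); first exact/flip.
    by rewrite /S3 [in RHS]exprS; ring.
have [delta d0 gap] : exists2 delta : R, 0 < delta &
    forall i j x y, nz i -> nz j -> i != j -> A x -> A y ->
      delta <= `|(- r i * x + 1) - (- r j * y + 1)|.
  pose img i := (fun x => - r i * x + 1) @` A.
  have cimg i : compact (img i).
    apply: continuous_compact => //; apply: continuous_subspaceT => x.
    by apply: cvgD; [apply: cvgM; [exact: cvg_cst|exact: cvg_id]|exact: cvg_cst].
  (* The gap holds for all small [d], so the finitely many pairs of images share one. *)
  have near_gap : \forall d \near (0 : R)^'+, forall ij : I * I,
      ij.1 != ij.2 -> forall x y, img ij.1 x -> img ij.2 y -> d <= `|x - y|.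
    apply: filter_forall => -[i j] /=; have [->|ij] := eqVneq i j; first by near=> d.
    have disj : img i `&` img j = set0.
      apply/seteqP; split=> // z [[x Ax <-] [y Ay]] /addIr; rewrite !mulNr => /oppr_inj.
      move=> /esym /(inj _ _ _ _ _ _ Ax Ay) [e1 e2].
      by case/eqP: ij; case: i j e1 e2 => ? ? [? ?] /= /val_inj -> /val_inj ->.
    by apply: filterS (compact_disjoint_gap _ _ (cimg i) (cimg j) disj) => d hd _.
  near (0 : R)^'+ => d; exists d; first by near: d; exact: nbhs_right_gt.
  move=> i j x y _ _ ij Ax Ay.
  have : forall ij : I * I, ij.1 != ij.2 ->
    forall x y, img ij.1 x -> img ij.2 y -> d <= `|x - y| by near: d.
  by apply; [exact: (ij : (i, j).1 != (i, j).2)|exists x|exists y].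
have nA : hausdorff_null s A.
  move=> e d e0 dd; have [U [KU UU]] := nK e d e0 dd.
  by exists U; split=> // x /AK/KU.
have d2 : 0 < (delta / 2) `^ s by rewrite powR_gt0 // divr_gt0.
have [l lA] := null_finite_cover _ _ _ s0 d2 cA nA.
apply/negP; rewrite -leNgt.
apply: (@separated_cost R I nz (fun i => - r i) (fun=> 1) A) => //.
- by case: Kat => _ [[x Kx] _]; exists (S3 p x); left; exists x.
- by move=> i _; rewrite oppr_eq0 gt_eqF.
- move=> i _; have [->|ne] := eqVneq i (ord_max, ord0); last first.
    exists (ord_max, ord0) => //.
    by rewrite /nz xpair_eqE eqxx andbT -val_eqE /= -lt0n.
  exists (ord0, ord_max); first by rewrite /nz xpair_eqE eqxx /= -val_eqE /= -lt0n.
  by rewrite xpair_eqE negb_and -!val_eqE /= -lt0n M0.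
under eq_bigr => i _.
  have -> : `|- r i| `^ s = P ^+ i.1 * Q ^+ i.2.
    rewrite normrN gtr0_norm // /r powRM ?exprn_ge0 ?(ltW p0) ?(ltW q0) //.
    by rewrite !powR_exprn ?(ltW p0) ?(ltW q0).
  over.
have := sum_pair_geometric P Q M; rewrite -/nz; set S := \sum_(i | _) _.
move: PM QM; have : 0 <= P ^+ M.+1 by rewrite exprn_ge0 //; case/andP: P01.
have : 0 <= Q ^+ M.+1 by rewrite exprn_ge0 //; case/andP: Q01.
move: (P ^+ M.+1) (Q ^+ M.+1) P01 Q01 => PM QM /andP[P0 P1] /andP[Q0 Q1] PM0 QM0 hP hQ hS.
rewrite leNgt; apply/negP => S1.
have : (1 - P) * (1 - Q) * (1 + S) <= (1 - P) * (1 - Q) * 2.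
  by rewrite ler_wpM2l ?mulr_ge0 //; lra.
have : (1 - PM) * (1 - QM) = 1 - PM - QM + PM * QM by ring.
have : 0 <= PM * QM by exact: mulr_ge0.
lra.
Unshelve. all: by end_near.
Qed.

(** * The dimension equation *)

(** At exponent [0] every nonempty set costs [1], even a single point. This settles the exponent
    that [twofold_not_null] leaves out. *)
Lemma nonempty_not_null0 {R : realType} (K : set R) :
  K !=set0 -> ~ hausdorff_null 0 K.
Proof.
move=> [x Kx] /(_ 1 1 ltr01 ltr01)[U [KU [_]]]; apply/negP; rewrite -leNgt.
have [i _ Uix] := KU _ Kx.
apply: le_trans (nneseries_lim_ge i.+1 _); last first.
  by move=> k _ _; rewrite lee_fin hterm_ge0.
rewrite sumEFin lee_fin big_nat_recr //= -[leLHS]add0r lerD //.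
  by apply: sumr_ge0 => k _; exact: hterm_ge0.
by rewrite /hterm asboolF ?powRr0 // => U0; rewrite U0 in Uix.
Qed.

Lemma dimension_equation_continuous {R : realType} (p q : R) :
  0 < p -> 0 < q ->
  continuous (fun s : R => p `^ s + q `^ s - (p * q) `^ s).
Proof.
move=> p0 q0 s.
have cpow (a : R) : 0 < a -> (a `^ t @[t --> s] --> a `^ s).
  move=> a0; rewrite [powR a](_ : _ = expR \o (fun t => t * ln a)); last first.
    by apply/funext => t; rewrite /powR gt_eqF.
  apply: continuous_comp; last exact: continuous_expR.
  by apply: cvgM; [exact: cvg_id|exact: cvg_cst].
by apply: cvgB; [apply: cvgD; exact: cpow|apply: cpow; exact: mulr_gt0].
Qed.

Theorem theorem4 (R : realType) (p q : R) (K : set R) :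
  0 < p -> p < 1 / 2 -> 0 < q -> q < 1 / 2 ->
  is_attractor p q K -> twofold p q K ->
  let d := hausdorff_dim K in
  powR p d + powR q d - powR (p * q) d = 1 / 2.
Proof.
move=> p0 p2 q0 q2 Kat tw d.
have p02 : 0 < p < 1 / 2 by rewrite p0.
have q02 : 0 < q < 1 / 2 by rewrite q0.
pose E := [set s : R | 0 <= s /\ hausdorff_null s K].
(* At exponent [2] the expression is [1 - (1 - p^2) * (1 - q^2) < 7 / 16]. *)
have E2 : E 2.
  split; first by [].
  apply: (attractor_null p q) => //; rewrite !powR_mulrn ?mulr_ge0 ?ltW //; nra.
have lbE : has_lbound E by exists 0 => s [].
have d0 : 0 <= d by apply: lb_le_inf; [exists 2|move=> s []].
have cphi := dimension_equation_continuous p q p0 q0 d.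
apply/eqP; rewrite eq_le; apply/andP; split; rewrite leNgt; apply/negP => hd.
(* The excess persists on [[d, d + e)], where the infimum provides a null exponent. *)
- have /nbhs_ballP[e /= e0 he] : \forall s \near d, 1 / 2 < p `^ s + q `^ s - (p * q) `^ s.
    exact: cvgr_gt cphi _ hd.
  have [s [s0 nS] sd] : exists2 s, E s & s < d + e.
    by apply: inf_lt; [exists 2|rewrite ltrDl].
  have ds : d <= s by apply: ge_inf.
  have sn0 : 0 < s.
    rewrite lt_neqAle s0 andbT; apply/negP => /eqP s00.
    by apply: (@nonempty_not_null0 R K); [case: Kat => _ []|rewrite s00].
  apply: (twofold_not_null p q s K) => //; apply: he.
  by rewrite -ball_normE /= distrC ger0_norm ?subr_ge0 // ltrBlDl.
(* The deficit persists just below [d], giving a null exponent smaller than the infimum. *)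
- have /nbhs_ballP[e /= e0 he] : \forall s \near d, p `^ s + q `^ s - (p * q) `^ s < 1 / 2.
    exact: cvgr_lt cphi _ hd.
  (* At exponent [0] the expression is [1], so there is room below [d]. *)
  have dn0 : 0 < d.
    rewrite lt_neqAle d0 andbT; apply/negP => /eqP d00.
    by move: hd; rewrite -d00 !powRr0; lra.
  pose m := Num.min d e; have m0 : 0 < m by rewrite lt_min dn0.
  have [md me] : m <= d /\ m <= e by rewrite !ge_min !lexx orbT.
  have : d <= d - m / 2.
    apply: ge_inf => //; split; first by lra.
    apply: (attractor_null p q) => //; first by lra.
    apply: he; rewrite -ball_normE /= opprB addrC subrK gtr0_norm; lra.
  lra.
Qed.
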